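(* Let $G$ be a finite simple graph with vertex set $V(G)=\{t_1,\ldots,t_s\}$, let $S=K[t_1,\ldots,t_s]$ be a polynomial ring over a field $K$, and let $I(G)\subset S$ be the edge ideal of $G$. If $G$ is an edge-critical graph without isolated vertices and $\beta_0(G)=2$, then $G$ is in $W_2$ and $$\mathrm{v}(I(G))=\mathrm{reg}(S/I(G))=2.$$
   Context: The edge ideal $I(G)$ is the ideal of $S$ generated by all $t_it_j$ with $\{t_i,t_j\}\in E(G)$. A stable set is a set of pairwise non-adjacent vertices, a maximum stable set is a stable set of largest cardinality, and $\beta_0(G)$ is that largest cardinality. An edge $e$ of $G$ is critical if $\beta_0(G\setminus e)>\beta_0(G)$, where $G\setminus e$ is obtained by removing the edge $e$ and keeping all vertices; $G$ is edge-critical if all its edges are critical. $G$ belongs to the class $W_2$ if $|V(G)|\geq2$ and any $2$ disjoint stable sets are contained in $2$ disjoint maximum stable sets (each of the two stable sets being contained in one of the two disjoint maximum stable sets). With the standard grading $S=\bigoplus_{d\ge0}S_d$, and for $I\subsetneq\mathfrak{m}=(t_1,\ldots,t_s)$, the v-number is $\mathrm{v}(I)=\min\{d\geq 1\mid \exists f\in S_d\text{ and }\mathfrak{p}\in\mathrm{Ass}(I)\text{ with }(I\colon f)=\mathfrak{p}\}$, where $\mathrm{Ass}(I)$ is the set of associated primes of $S/I$ and $(I\colon f)=\{g\in S\mid gf\in I\}$. The regularity of $S/I$ is $\mathrm{reg}(S/I)=\max\{j-i\mid b_{i,j}\neq0\}$, where $b_{i,j}$ are the graded Betti numbers of the minimal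 graded free resolution of $S/I$ over $S$. *)

(* Defs.v *)
From HB Require Import structures.
From mathcomp Require Import all_boot all_order all_algebra.
From mathcomp Require Import mpoly.

Set Implicit Arguments.
Unset Strict Implicit.
Unset Printing Implicit Defensive.

Import GRing.Theory.

(* A simple graph on a finite vertex type T is a symmetric irreflexive
   relation e : rel T. *)
Section Graphs.
Variable T : finType.
Implicit Types (e : rel T) (A B : {set T}).

Definition stable e A : bool :=
  [forall x in A, forall y in A, ~~ e x y].

Definition beta0 e : nat := \max_(A : {set T} | stable e A) #|A|.

Definition max_stable e A : bool := stable e A && (#|A| == beta0 e).

Definition no_isolated e : Prop := forall x, exists y, e x y.

Definition del_edge e (x y : T) : rel T :=
  [rel u v | e u v && ~~ (((u == x) && (v == y)) || ((u == y) && (v == x)))].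

Definition critical e (x y : T) : Prop := beta0 e < beta0 (del_edge e x y).

Definition edge_critical e : Prop := forall x y, e x y -> critical e x y.

Definition in_W2 e : Prop :=
  2 <= #|T| /\
  forall A B, stable e A -> stable e B -> [disjoint A & B] ->
    exists A' B', [/\ max_stable e A', max_stable e B', [disjoint A' & B'],
                      A \subset A' & B \subset B'].

End Graphs.

Local Open Scope ring_scope.

(* Ideals of S = K[t_1, ..., t_s] are predicates on {mpoly K[s]}. *)
Section Ideals.
Variables (K : fieldType) (s : nat).
Local Notation S := {mpoly K[s]}.
Implicit Types (I P : S -> Prop).

Definition ideal_gen (A : S -> Prop) (f : S) : Prop :=
  exists2 l : seq (S * S),
    forall p, p \in l -> A p.2 & f = \sum_(p <- l) p.1 * p.2.

Definition is_ideal I : Prop :=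
  [/\ I 0, forall f g, I f -> I g -> I (f + g) & forall h f, I f -> I (h * f)].

Definition is_prime_ideal P : Prop :=
  [/\ is_ideal P, ~ P 1 & forall f g, P (f * g) -> P f \/ P g].

Definition colon I (f : S) : S -> Prop := fun g => I (g * f).

Definition same_ideal I P : Prop := forall g, I g <-> P g.

(* The annihilator of the class of f in S/I is (I : f). *)
Definition associated_prime I P : Prop :=
  is_prime_ideal P /\ exists f, same_ideal (colon I f) P.

Definition irrelevant_ideal : S -> Prop :=
  ideal_gen (fun f => exists i : 'I_s, f = 'X_i).

Definition edge_ideal (e : rel 'I_s) : S -> Prop :=
  ideal_gen (fun f => exists i j : 'I_s, e i j /\ f = 'X_i * 'X_j).

Definition v_witness I (d : nat) : Prop :=
  (1 <= d)%N /\
  exists (f : S) (P : S -> Prop),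
    [/\ f \is d.-homog, associated_prime I P & same_ideal (colon I f) P].

Definition is_v_number I (v : nat) : Prop :=
  v_witness I v /\ forall d, v_witness I d -> (v <= d)%N.

End Ideals.

Arguments edge_ideal K {s} e _.

(* A sequence ... -> F_2 -> F_1 -> F_0 -> S/I of graded free modules of finite
   rank.  F_i has a homogeneous basis indexed by 'I_(gf_rank i), whose a-th
   element has degree gf_deg a; elements of F_i are row vectors, the map
   F_(i+1) -> F_i is u |-> u *m gf_diff i, and F_0 -> S/I sends u to the class
   of (u *m gf_aug) 0 0.  Natural-number degrees suffice: S/I is generated in
   degree 0, so a minimal graded resolution involves no negative degree. *)
Record graded_free_seq (K : fieldType) (s : nat) := GradedFreeSeq {
  gf_rank : nat -> nat;
  gf_deg : forall i, 'I_(gf_rank i) -> nat;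
  gf_diff : forall i, 'M[{mpoly K[s]}]_(gf_rank i.+1, gf_rank i);
  gf_aug : 'cV[{mpoly K[s]}]_(gf_rank 0) }.

Section Resolutions.
Variables (K : fieldType) (s : nat).
Local Notation S := {mpoly K[s]}.
Implicit Types (I : S -> Prop) (F : graded_free_seq K s).

(* The maps preserve degrees; a nonzero entry of gf_diff i at (a, b) is
   homogeneous of degree gf_deg a - gf_deg b, which must be nonnegative. *)
Definition gf_graded F : Prop :=
  (forall i a b, gf_diff F i a b = 0 \/
     exists2 k : nat, gf_diff F i a b \is k.-homog
                    & gf_deg a = (gf_deg b + k)%N)
  /\ forall a, gf_aug F a 0 \is (gf_deg a).-homog.

Definition gf_exact I F : Prop :=
  [/\ forall f : S, exists u : 'rV[S]_(gf_rank F 0),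
        I (f - (u *m gf_aug F) 0 0),
      forall u : 'rV[S]_(gf_rank F 0),
        I ((u *m gf_aug F) 0 0) <-> exists v, u = v *m gf_diff F 0
    & forall i (u : 'rV[S]_(gf_rank F i.+1)),
        u *m gf_diff F i = 0 <-> exists v, u = v *m gf_diff F i.+1].

Definition gf_minimal F : Prop :=
  forall i a b, irrelevant_ideal (gf_diff F i a b).

Definition minimal_graded_free_resolution I F : Prop :=
  [/\ gf_graded F, gf_exact I F & gf_minimal F].

Definition gf_betti F (i j : nat) : nat :=
  #|[set a : 'I_(gf_rank F i) | gf_deg a == j]|.

(* b is the table of graded Betti numbers of S/I; it is unique because minimal
   graded free resolutions are unique up to isomorphism. *)
Definition graded_betti_numbers I (b : nat -> nat -> nat) : Prop :=
  exists2 F, minimal_graded_free_resolution I F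
           & forall i j, b i j = gf_betti F i j.

Definition is_regularity I (r : int) : Prop :=
  exists2 b, graded_betti_numbers I b &
    (exists i j, b i j <> 0%N /\ j%:Z - i%:Z = r) /\
    (forall i j, b i j <> 0%N -> j%:Z - i%:Z <= r).

End Resolutions.

(* Main.v *)
Require Import Defs.
From mathcomp Require Import all_boot all_order all_algebra.
From mathcomp Require Import mpoly zify.
From Stdlib Require Import Classical ClassicalEpsilon.

(* The complement of [G] is a triangle-free graph in which, by criticality, any
   two non-adjacent vertices have a common neighbour and, in the absence of
   isolated vertices, every vertex has degree at least two.  This gives [W_2] by
   matching vertices greedily, and [v(I) = 2] because [(I : t_a t_b)] is
   generated by the other variables when [ab] is an edge of the complement,
   while a linear form [f] with [t_x] in its support would put into the prime
   [(I : f)] the product [t_y t_z], but neither factor, for two neighbours [y]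
   and [z] of [x] in the complement.

   The regularity is read off Koszul homology.  Call [F/N] [r]-regular when its
   Koszul complex is exact in coefficient degrees above [r].  Then the module [N]
   is generated in degrees at most [r+1], and, for a minimal cover of [N] by a
   free module [F'] with kernel [N'], the quotient [F'/N'] is [(r+1)]-regular;
   iterating produces a minimal graded resolution with [F_i] generated in degrees
   at most [i+r].  Conversely, if every [F_i] is generated in degrees at most
   [i+q], then the resolved module is [q]-regular.  Contracting along a variable
   of exponent at least two shows that [S/I] is [2]-regular, and an edge on a
   cycle of the complement gives a Koszul class showing that it is not
   [1]-regular. *)

Set Implicit Arguments.
Unset Strict Implicit.
Unset Printing Implicit Defensive.

Import GRing.Theory.

(** * Coefficients of polynomials *)

Section Coefficients.
Local Open Scope ring_scope.
Variables (K : fieldType) (s : nat).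
Local Notation S := {mpoly K[s]}.
Implicit Types (p q : S) (m : 'X_{1..s}).

Lemma mcoeff_sign k p m : ((-1) ^+ k * p)@_m = (-1) ^+ k * p@_m.
Proof.
rewrite -signr_odd -[X in _ = X * _]signr_odd.
by case: (odd k); rewrite ?mulN1r ?mul1r ?mcoeffN.
Qed.

Lemma mnm1_le m x : (0 < m x)%N -> (U_(x) <= m)%MM.
Proof.
by move=> mx; apply/mnm_lepP => j; rewrite mnm1E; case: eqP => // <-.
Qed.

Lemma mcoeffXM x p m :
  ('X_x * p)@_m = if (0 < m x)%N then p@_(m - U_(x)) else 0.
Proof.
case: ifP => mx; first by rewrite mulrC -{1}(submK (mnm1_le mx)) addmC mcoeffMX.
apply/eqP; rewrite mcoeff_eq0; apply/negP => /msuppM_le.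
rewrite msuppX => /allpairsP[[m1 m2] /=]; rewrite inE => -[/eqP -> _ mE].
by move: mx; rewrite mE mnmDE mnm1E eqxx.
Qed.

Lemma mcoeffM_neq0 p q m : (p * q)@_m != 0 ->
  exists m1 m2, [/\ p@_m1 != 0, q@_m2 != 0 & m = (m1 + m2)%MM].
Proof.
rewrite -mcoeff_msupp => /msuppM_le /allpairsP[[m1 m2] /= [h1 h2 ->]].
by exists m1, m2; rewrite -!mcoeff_msupp.
Qed.

(** The degree cut-off makes the support finite, so that a polynomial can be given by prescribing
    its coefficients. *)
Definition mpoly_upto d (F : 'X_{1..s} -> K) : S :=
  \sum_(m : 'X_{1..s < d.+1}) F m *: 'X_[m].

Lemma mcoeff_upto d F m :
  (mpoly_upto d F)@_m = if (mdeg m <= d)%N then F m else 0.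
Proof.
rewrite /mpoly_upto; case: ifP => hm; first exact: mcoeff_mpoly.
rewrite raddf_sum /= big1 // => m' _; rewrite mcoeffZ mcoeffX.
case: eqP => [mE|]; last by rewrite mulr0.
by move: (bmdeg m') hm; rewrite mE ltnS => ->.
Qed.

Lemma dhomog_coeffP d p :
  p \is d.-homog <-> forall m, p@_m != 0 -> mdeg m = d.
Proof.
by split=> [/dhomogP h m | h]; [|apply/dhomogP => m]; rewrite -?mcoeff_msupp;
   [apply: h | rewrite mcoeff_msupp; apply: h].
Qed.

End Coefficients.

(** * The Koszul complex and its contraction in a multidegree *)

Section Koszul.
Local Open Scope ring_scope.
Variables (K : fieldType) (s : nat).
Local Notation S := {mpoly K[s]}.
Implicit Types (A B : {set 'I_s}) (c w : {set 'I_s} -> S) (m : 'X_{1..s}).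

(** The parity is that of the permutation sorting [x] into [A], that is, the sign in the wedge of
    [e_x] with [e_A]. *)
Definition ksign (x : 'I_s) A : nat := #|[set y in A | (y < x)%N]|.

Lemma ksignU1 (x y : 'I_s) A : y \notin A ->
  ksign x (y |: A) = (ksign x A + (y < x))%N.
Proof.
move=> yA; rewrite /ksign; case: (boolP (y < x)%N) => yx.
  have -> : [set z in y |: A | (z < x)%N] = y |: [set z in A | (z < x)%N].
    by apply/setP=> z; rewrite !inE; case: eqP => // ->; rewrite yx.
  by rewrite cardsU1 inE (negPf yA) /= addnC.
rewrite addn0; apply: eq_card => z; rewrite !inE.
by case: eqP => // ->; rewrite (negPf yA) (negPf yx).
Qed.

Lemma ksign_swap (x y : 'I_s) A : x != y -> x \notin A -> y \notin A ->
  (-1) ^+ (ksign y (x |: A) + ksign x (y |: A))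
    = - (-1) ^+ (ksign x A + ksign y A) :> K.
Proof.
move=> xy xA yA; rewrite !ksignU1 //.
have -> : (ksign y A + (x < y) + (ksign x A + (y < x)) =
           (ksign x A + ksign y A).+1)%N.
  have : nat_of_ord x != y by [].
  by case: ltngtP => // _ _; lia.
by rewrite exprS mulN1r.
Qed.

(** The coefficient at [e_B] of the Koszul boundary of the sum of all [c A] times [e_A]; all
    exterior degrees are treated at once. *)
Definition kdiff c B : S :=
  \sum_(x | x \notin B) (-1) ^+ (ksign x B) * ('X_x * c (x |: B)).

Lemma mcoeff_kdiff c B m :
  (kdiff c B)@_m = \sum_(x | (x \notin B) && (0 < m x)%N)
     (-1) ^+ (ksign x B) * (c (x |: B))@_(m - U_(x)).
Proof.
rewrite /kdiff raddf_sum /= big_mkcondr /=; apply: eq_bigr => x _.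
by rewrite mcoeff_sign mcoeffXM; case: ifP; rewrite ?mulr0.
Qed.

Lemma eq_kdiff c c' B : c =1 c' -> kdiff c B = kdiff c' B.
Proof. by move=> cc; apply: eq_bigr => x _; rewrite cc. Qed.

Lemma kdiff_kdiff c B : kdiff (kdiff c) B = 0.
Proof.
pose F (x y : 'I_s) : S := (-1) ^+ (ksign x B + ksign y (x |: B)) *
  ('X_x * 'X_y * c (y |: (x |: B))).
have antiF x y : x != y -> x \notin B -> y \notin B -> F x y = - F y x.
  move=> xy xB yB; rewrite /F setUCA ['X_y * _]mulrC.
  rewrite !ksignU1 // -mulNr; congr (_ * _).
  have : nat_of_ord x != y by [].
  case: ltngtP => // _ _; rewrite ?addn0 !addnA ?addn1 ?exprS addnC ?mulN1r ?opprK //.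
have -> : kdiff (kdiff c) B =
    \sum_(x | x \notin B) \sum_(y | (y \notin B) && (x != y)) F x y.
  apply: eq_bigr => x xB; rewrite /kdiff !mulr_sumr.
  apply: eq_big => [y | y _].
    by rewrite !inE negb_or andbC eq_sym.
  by rewrite /F exprD !mulrA; congr (_ * _ * _); rewrite mulrAC.
(* Splitting the ordered pairs by [x < y] and [y < x] pairs each term with its opposite without
   dividing by two, so characteristic two is covered. *)
rewrite (eq_bigr (fun x : 'I_s => \sum_(y : 'I_s | (y \notin B) && (x < y)%N) F x y
           + \sum_(y : 'I_s | (y \notin B) && (y < x)%N) F x y)); last first.
  move=> x xB; rewrite (bigID (fun y : 'I_s => (x < y)%N)) /=; congr (_ + _);
    apply: eq_bigl => y; rewrite -andbA; congr (_ && _); rewrite -val_eqE /=;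
    by case: ltngtP.
rewrite big_split /=.
rewrite [X in _ + X](exchange_big_dep (fun y => y \notin B)) /=; last first.
  by move=> x y _ /andP[].
rewrite -big_split /= big1 // => x xB.
rewrite [X in _ + X](eq_bigl (fun y : 'I_s => (y \notin B) && (x < y)%N));
  last by move=> y; rewrite xB.
rewrite -big_split /= big1 // => y /andP[yB xy].
by rewrite (antiF x y) ?addNr // -val_eqE neq_ltn xy.
Qed.

(** The multidegree of [X^m e_A]. The differential preserves it, since taking [x] out of [A]
    multiplies the coefficient by [X_x]. *)
Definition kmonom m A : 'X_{1..s} := (m + [multinom (x \in A : nat) | x < s])%MM.

(* [pivot] depends only on the multidegree [m + 1_A]; wedging with [e_x] and
   dividing by [X_x], where [x] is the pivot, contracts the Koszul complex in
   each multidegree. *)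
Lemma koszul_contraction (good : pred 'X_{1..s}) (pivot : 'X_{1..s} -> 'I_s) d c :
  (forall A, c A \is d.+1.-homog) ->
  (forall m A, mdeg m = d.+1 -> good m ->
     (0 < kmonom m A (pivot (kmonom m A)))%N /\
     (pivot (kmonom m A) \in A -> good (m + U_(pivot (kmonom m A)))%MM)) ->
  (forall B m, good m -> (kdiff c B)@_m = 0) ->
  exists2 w, forall A, w A \is d.-homog
           & forall A m, good m -> (c A - kdiff w A)@_m = 0.
Proof.
move=> ch pv cyc.
pose w A := mpoly_upto d (fun m => let x := pivot (kmonom m A) in
  if (mdeg m == d) && (x \in A) then
    (-1) ^+ ksign x (A :\ x) * (c (A :\ x))@_(m + U_(x)) else 0).
have wh A : w A \is d.-homog.
  apply/dhomog_coeffP => m; rewrite mcoeff_upto; case: ifP; rewrite ?eqxx //= => _.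
  by case: (mdeg m =P d) => //=; rewrite eqxx.
exists w => // A m gm.
have [md|md] := eqVneq (mdeg m) d.+1; last first.
  rewrite mcoeffB (dhomog_nemf_coeff (ch A)) //.
  rewrite mcoeff_kdiff big1 ?subrr // => x /andP[_ mx].
  rewrite (dhomog_nemf_coeff (wh _)) ?mulr0 //.
  apply: contra md => /eqP <-; rewrite -{1}(submK (mnm1_le mx)) mdegD mdeg1 addn1 //.
have [] := pv m A md gm; set x := pivot _ => kx gx.
(* All terms of the boundary at [A] and [m] share one multidegree, hence the same pivot [x]. *)
have kmE y : y \notin A -> (0 < m y)%N -> kmonom (m - U_(y)) (y |: A) = kmonom m A.
  move=> yA my; apply/mnmP => z; rewrite !(mnmDE, mnmBE, mnm1E, mnmE) !inE [z == y]eq_sym.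
  by case: (eqVneq z y) => [->|_] /=; rewrite ?(negPf yA) ?addn0 ?subnK ?subn0.
have wE y : y \notin A -> (0 < m y)%N -> (w (y |: A))@_(m - U_(y)) =
   if x \in y |: A then (-1) ^+ ksign x ((y |: A) :\ x) * (c ((y |: A) :\ x))@_(m - U_(y) + U_(x)) else 0.
  move=> yA my; rewrite mcoeff_upto kmE //.
  have -> : mdeg (m - U_(y)) = d.
    by move: md; rewrite -{1}(submK (mnm1_le my)) mdegD mdeg1 addn1 => -[].
  by rewrite leqnn eqxx.
rewrite mcoeffB mcoeff_kdiff.
have [xA|xA] := boolP (x \in A); last first.
  have mx : (0 < m x)%N by move: kx; rewrite mnmDE mnmE (negPf xA) addn0.
  rewrite (bigD1 x) /=; last by rewrite xA.
  rewrite big1 ?addr0 => [|y /andP[/andP[yA my] yx]]; last first.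
    by rewrite wE // !inE (negPf xA) eq_sym (negPf yx) mulr0.
  rewrite wE // setU11 setU1K // mulrA -exprD addnn -mul2n exprM sqrrN.
  by rewrite !expr1n mul1r (submK (mnm1_le mx)) subrr.
(* When [x] is in [A], the cycle condition at [B] and [m + U_(x)] expresses the coefficient of [c A]
   through the remaining terms, which are those of [kdiff w A]. *)
pose B := A :\ x.
have xB : x \notin B by rewrite !inE eqxx.
have AE : x |: B = A by rewrite setD1K.
have := cyc B _ (gx xA); rewrite mcoeff_kdiff (bigD1 x) /=; last first.
  by rewrite xB mnmDE mnm1E eqxx addn1.
rewrite AE addmK => /eqP; rewrite addr_eq0 => /eqP/(congr1 ( *%R ((-1) ^+ ksign x B))).
rewrite mulrA -exprD addnn -mul2n exprM sqrrN !expr1n mul1r => ->.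
apply/eqP; rewrite subr_eq0 mulrN; apply/eqP.
rewrite mulr_sumr -sumrN; apply: eq_big => [y|y].
  rewrite !inE mnmDE mnm1E.
  by case: (eqVneq y x) => [->|yx] /=; rewrite ?andbT ?andbF ?xA ?andbF //= addn0.
rewrite -andbA mnmDE mnm1E => /and3P[yB my yx].
rewrite eq_sym (negPf yx) addn0 in my.
have yA : y \notin A by move: yB; rewrite !inE yx.
rewrite wE // inE xA orbT.
have -> : (y |: A) :\ x = y |: B.
  by apply/setP=> z; rewrite !inE; case: (eqVneq z x) => // ->; rewrite eq_sym (negPf yx).
have -> : (m - U_(y) + U_(x) = m + U_(x) - U_(y))%MM.
  apply/mnmP => z; rewrite !(mnmDE, mnmBE, mnm1E).
  by case: (eqVneq y z) => [<-|_] /=; lia.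
by rewrite !mulrA -!exprD -{1}AE ksign_swap 1?eq_sym // mulNr.
Qed.

End Koszul.

(** * Regularity of graded modules and its transfer along syzygies *)

Section GradedModules.
Local Open Scope ring_scope.
Variables (K : fieldType) (s : nat).
Local Notation S := {mpoly K[s]}.

Section OneModule.
Variables (n : nat) (deg : 'I_n -> nat).
Implicit Types (u v : 'rV[S]_n) (z w : {set 'I_s} -> 'rV[S]_n) (A B : {set 'I_s}).

Definition vhom d u : Prop :=
  forall b m, (u 0 b)@_m != 0 -> (mdeg m + deg b)%N = d.

Definition vproj d u : 'rV[S]_n :=
  \row_b mpoly_upto d (fun m => if (mdeg m + deg b == d)%N then (u 0 b)@_m else 0).

Lemma mcoeff_vproj d u b m :
  (vproj d u 0 b)@_m = if (mdeg m + deg b == d)%N then (u 0 b)@_m else 0.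
Proof.
rewrite mxE mcoeff_upto; case: ifP => // md; case: eqP => // E.
by move: md; rewrite -E leq_addr.
Qed.

Lemma vproj_hom d u : vhom d (vproj d u).
Proof. by move=> b m; rewrite mcoeff_vproj; case: (_ =P d) => //; rewrite eqxx. Qed.

Lemma row_mcoeffP u v : (forall b m, (u 0 b)@_m = (v 0 b)@_m) -> u = v.
Proof. by move=> h; apply/rowP => b; apply/mpolyP => m. Qed.

Lemma vproj_id d u : vhom d u -> vproj d u = u.
Proof.
move=> hu; apply: row_mcoeffP => b m; rewrite mcoeff_vproj.
by case: eqP => // ne; apply/esym/eqP/negPn/negP => /hu.
Qed.

Lemma vhom0 d : vhom d 0.
Proof. by move=> b m; rewrite mxE mcoeff0 eqxx. Qed.

Lemma vhomB d u v : vhom d u -> vhom d v -> vhom d (u - v).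
Proof.
move=> hu hv b m; rewrite !mxE mcoeffB.
by case: (eqVneq (u 0 b)@_m 0) => [->|/hu //]; rewrite sub0r oppr_eq0 => /hv.
Qed.

Definition vdiff z B : 'rV[S]_n := \row_b kdiff (fun A => z A 0 b) B.

Lemma vdiffE z B :
  vdiff z B = \sum_(x | x \notin B) ((-1) ^+ (ksign x B) * 'X_x) *: z (x |: B).
Proof.
apply/rowP => b; rewrite mxE summxE; apply: eq_bigr => x _.
by rewrite mxE mulrA.
Qed.

Lemma eq_vdiff z w B : z =1 w -> vdiff z B = vdiff w B.
Proof. by move=> zw; rewrite !vdiffE; apply: eq_bigr => x _; rewrite zw. Qed.

Lemma vdiffB z w B : vdiff (fun A => z A - w A) B = vdiff z B - vdiff w B.
Proof.
rewrite !vdiffE -sumrB; apply: eq_bigr => x _.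
by rewrite scalerBr.
Qed.

Lemma vdiff_eq0 z B : (forall x, x \notin B -> z (x |: B) = 0) -> vdiff z B = 0.
Proof. by move=> h; rewrite vdiffE big1 // => x /h ->; rewrite scaler0. Qed.

Lemma vdiff_vdiff z B : vdiff (vdiff z) B = 0.
Proof.
apply/rowP => b; rewrite !mxE -[RHS](kdiff_kdiff (fun A => z A 0 b) B).
by apply: eq_kdiff => A; rewrite mxE.
Qed.

Lemma vhom_vdiff d z B : (forall A, vhom d (z A)) -> vhom d.+1 (vdiff z B).
Proof.
move=> hz b m; rewrite mxE mcoeff_kdiff => nz.
have [x /andP[xB mx] ] : exists2 x, (x \notin B) && (0 < m x)%N
    & (z (x |: B) 0 b)@_(m - U_(x)) != 0.
  apply: NNPP => H; move: nz; rewrite big1 ?eqxx // => x hx.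
  case: (eqVneq (z (x |: B) 0 b)@_(m - U_(x)) 0) => [->|nz]; first by rewrite mulr0.
  by case: H; exists x.
by move/hz <-; rewrite -{1}(submK (mnm1_le mx)) mdegD mdeg1 addn1.
Qed.

Definition submodule (N : 'rV[S]_n -> Prop) : Prop :=
  [/\ N 0, forall u v, N u -> N v -> N (u + v) & forall f u, N u -> N (f *: u)].

Definition graded_submodule (N : 'rV[S]_n -> Prop) : Prop :=
  submodule N /\ forall d u, N u -> N (vproj d u).

Lemma submoduleB N u v : submodule N -> N u -> N v -> N (u - v).
Proof. by case=> _ ND NZ Nu Nv; rewrite -scaleN1r; apply/ND/NZ. Qed.

Lemma submodule_sum N (I : Type) (r : seq I) (P : pred I) (F : I -> 'rV[S]_n) :
  submodule N -> (forall i, P i -> N (F i)) -> N (\sum_(i <- r | P i) F i).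
Proof. by case=> N0 ND _; apply: big_ind. Qed.

(* For [F] free with basis degrees [deg], the module [F/N] satisfies
   [koszul_reg N r s] iff its Koszul homology vanishes in coefficient degrees
   above [r], that is, iff its regularity is at most [r].  The homological
   position is recorded only through the cut-off [p]. *)
Definition koszul_reg (N : 'rV[S]_n -> Prop) r p : Prop :=
  forall d z, (r <= d)%N -> (forall A, vhom d.+1 (z A)) ->
    (forall A : {set 'I_s}, (p < #|A|)%N -> z A = 0) ->
    (forall B, N (vdiff z B)) ->
  exists2 w, forall A, vhom d (w A) & forall A, N (z A - vdiff w A).

Lemma card_set_ord (A : {set 'I_s}) : (s < #|A|)%N = false.
Proof. by apply/negbTE; rewrite -leqNgt (leq_trans (max_card _)) ?card_ord. Qed.

(** Above degree [r] every coordinate has positive polynomial degree, so some variable occurs in the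
    multidegree and can be the pivot; [x0] only fills the impossible case of [pick]. *)
Lemma free_koszul_reg r (x0 : 'I_s) :
  (forall b, (deg b <= r)%N) -> koszul_reg (fun u => u = 0) r s.
Proof.
move=> hr d z rd hz _ cz.
pose pivot (m : 'X_{1..s}) := odflt x0 [pick x | (0 < m x)%N].
have H b : exists w : {set 'I_s} -> S, (forall A : {set 'I_s}, w A \is (d - deg b).-homog)
    /\ forall A, z A 0 b = kdiff w A.
  have db : (deg b <= d)%N := leq_trans (hr b) rd.
  have [||B m _|w hw wz] :=
    @koszul_contraction K s predT pivot (d - deg b) (fun A => z A 0 b).
  - by move=> A; apply/dhomog_coeffP => m /hz; lia.
  - move=> m A md _; split=> //; rewrite /pivot; case: pickP => //= none.
    have : mdeg m = 0%N.
      rewrite mdegE big1 // => i _; have := none i.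
      by rewrite mnmDE; lia.
    by rewrite md.
  - by have /rowP/(_ b) := cz B; rewrite !mxE => ->; rewrite mcoeff0.
  exists w; split=> // A; apply/mpolyP => m; apply/eqP.
  by rewrite -subr_eq0 -mcoeffB wz.
have [w hw] := fin_all_exists H.
exists (fun A => \row_b w b A) => [A b m|A].
  rewrite mxE => /(proj1 (dhomog_coeffP _ _) ((hw b).1 A)) ->.
  by rewrite subnK // (leq_trans (hr b)).
apply/rowP => b; rewrite !mxE (hw b).2; apply/eqP; rewrite subr_eq0; apply/eqP.
by apply: eq_kdiff => B; rewrite mxE.
Qed.

(** Freeness writes [u] as the boundary of some [w], which is then a cycle modulo [N]. By regularity
    [w] is a boundary [vdiff v] modulo [N], and [w - vdiff v] has entries in [N] and still has
    boundary [u]. *)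
Lemma koszul_reg_generators (N : 'rV[S]_n -> Prop) r d u (x0 : 'I_s) :
  (forall b, (deg b <= r)%N) -> submodule N -> koszul_reg N r s ->
  (r <= d)%N -> vhom d.+2 u -> N u ->
  exists2 v : 'I_s -> 'rV[S]_n,
    forall x, N (v x) /\ vhom d.+1 (v x) & u = \sum_x 'X_x *: v x.
Proof.
move=> hr sN regN rd hu Nu.
pose z (A : {set 'I_s}) : 'rV[S]_n := if A == set0 then u else 0.
have z0 B x : z (x |: B) = 0.
  by rewrite /z; case: eqP => // /setP/(_ x); rewrite !inE eqxx.
have [||A|B|w hw wz] := @free_koszul_reg r x0 hr d.+1 z; rewrite ?card_set_ord //.
- exact: leqW.
- by move=> A; rewrite /z; case: eqP => // _; apply: vhom0.
- by apply: vdiff_eq0.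
have zE A : vdiff w A = z A by apply/esym/eqP; rewrite -subr_eq0 wz.
have [||A|B|v hv Nv] := regN d w; rewrite ?card_set_ord //.
  by rewrite zE /z; case: eqP => // _; case: sN.
exists (fun x => w [set x] - vdiff v [set x]) => [x|].
  by split; [apply: Nv | apply: vhomB; [|apply: vhom_vdiff]].
have -> : u = vdiff (fun A => w A - vdiff v A) set0.
  by rewrite vdiffB vdiff_vdiff subr0 zE /z eqxx.
rewrite vdiffE; apply: eq_big => [x|x _]; first by rewrite inE.
rewrite setU0 /ksign (_ : [set y in set0 | _] = set0) ?cards0 ?mul1r //.
by apply/setP => y; rewrite !inE.
Qed.

End OneModule.

Section TwoModules.
Variables (n m : nat) (deg : 'I_n -> nat) (deg' : 'I_m -> nat) (D : 'M[S]_(m, n)).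
Hypothesis D_hom :
  forall a b (k : 'X_{1..s}), (D a b)@_k != 0 -> (mdeg k + deg b)%N = deg' a.

Lemma vproj_mulmx d v : vproj deg d (v *m D) = vproj deg' d v *m D.
Proof.
apply: row_mcoeffP => b k; rewrite mcoeff_vproj.
have kd a (p : S) : (forall l, p@_l != 0 -> ((mdeg l + deg' a)%N == d) != ((mdeg k + deg b)%N == d)) ->
    (p * D a b)@_k = 0.
  move=> hp; apply/eqP/negPn/negP => /mcoeffM_neq0[k1 [k2 [h1 h2 kE]]].
  have := hp _ h1; rewrite -(D_hom h2) kE mdegD addnA eqxx //.
rewrite !mxE raddf_sum /=; case: ifP => kb.
  rewrite raddf_sum; apply: eq_bigr => a _ /=.
  apply/eqP; rewrite -subr_eq0 -mcoeffB -mulrBl kd // => l.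
  by rewrite mcoeffB mcoeff_vproj kb; case: (_ =P d) => _; rewrite ?subrr ?eqxx.
rewrite raddf_sum big1 // => a _; apply: kd => l; rewrite mcoeff_vproj kb.
by case: (_ =P d) => //; rewrite eqxx.
Qed.

Lemma vhom_mulmx d v : vhom deg' d v -> vhom deg d (v *m D).
Proof. by move=> /vproj_id <-; rewrite -vproj_mulmx; apply: vproj_hom. Qed.

Lemma vdiff_mulmx (z : {set 'I_s} -> 'rV[S]_m) B :
  vdiff (fun A => z A *m D) B = vdiff z B *m D.
Proof.
rewrite !vdiffE mulmx_suml; apply: eq_bigr => x _.
by rewrite scalemxAl.
Qed.

Lemma hom_lift d u : vhom deg d u -> (exists v, u = v *m D) ->
  exists2 v, vhom deg' d v & u = v *m D.
Proof.
move=> /vproj_id uE [v uv]; exists (vproj deg' d v); first exact: vproj_hom.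
by rewrite -vproj_mulmx -uv.
Qed.

(** Zero is lifted to zero so that the cut-off on exterior degree survives the lifting in
    [koszul_reg_coker]. *)
Lemma hom_lift_family d (u : {set 'I_s} -> 'rV[S]_n) :
  (forall A, vhom deg d (u A)) -> (forall A, exists v, u A = v *m D) ->
  exists v, [/\ forall A, vhom deg' d (v A), forall A, u A = v A *m D
              & forall A, u A = 0 -> v A = 0].
Proof.
move=> hu Hu.
have H A : exists v, [/\ vhom deg' d v, u A = v *m D & u A = 0 -> v = 0].
  have [uA|/eqP uA] := eqVneq (u A) 0.
    by exists 0; rewrite mul0mx; split=> //; apply: vhom0.
  by have [v hv vE] := hom_lift (hu A) (Hu A); exists v.
have [v hv] := fin_all_exists H.
by exists v; split=> A; have [] := hv A.
Qed.

Variables (N : 'rV[S]_n -> Prop) (r : nat) (x0 : 'I_s).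
Hypothesis deg_le : forall b, (deg b <= r)%N.
Hypothesis N_im : forall u, N u <-> exists v, u = v *m D.

(** A cycle [z] modulo the kernel maps to a true cycle, hence to a boundary [vdiff w]. Regularity
    moves [w] into [N] without changing its boundary, and a lift of the result along [D] bounds
    [z]. *)
Lemma koszul_reg_ker :
  koszul_reg deg N r s -> koszul_reg deg' (fun v => v *m D = 0) r.+1 s.
Proof.
move=> regN [//|d] z; rewrite ltnS => rd hz _ cz.
have [||A|B|w hw wz] := free_koszul_reg x0 deg_le (d := d.+1) (z := fun A => z A *m D);
  rewrite ?card_set_ord //.
- exact: leqW.
- by move=> A; apply: vhom_mulmx.
- by rewrite vdiff_mulmx.
have wE A : vdiff w A = z A *m D by apply/esym/eqP; rewrite -subr_eq0 wz.
have [||A|B|v hv Nv] := regN d w; rewrite ?card_set_ord //.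
  by rewrite wE; apply/N_im; exists (z B).
have [A|A|u [hu uE _]] := @hom_lift_family d.+1 (fun A => w A - vdiff v A).
- by apply: vhomB => //; apply: vhom_vdiff.
- exact/N_im/Nv.
exists u => // A; rewrite mulmxBl -vdiff_mulmx -wE.
rewrite -(eq_vdiff _ uE) vdiffB vdiff_vdiff subr0 subrr //.
Qed.

(** The boundary of a cycle [z] modulo [N] lifts to a cycle [u] modulo the kernel, of exterior
    degree one less, which explains [p] and [p.+1]. If [v] bounds [u], then [z - v *m D] is a true
    cycle and bounds by freeness. *)
Lemma koszul_reg_coker p :
  koszul_reg deg' (fun v => v *m D = 0) r.+1 p -> koszul_reg deg N r p.+1.
Proof.
move=> reg d z rd hz z0 cz.
have [A|A|u [hu uE u0]] := @hom_lift_family d.+2 (vdiff z).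
- exact: vhom_vdiff.
- exact/N_im.
have [||A pA|B|v hv vE] := reg d.+1 u => //.
- apply: u0; apply: vdiff_eq0 => x xA; apply: z0.
  by rewrite cardsU1 xA.
- by rewrite -vdiff_mulmx -(eq_vdiff _ uE) vdiff_vdiff.
have [||A|B|w hw wE] := free_koszul_reg x0 deg_le (d := d) (z := fun A => z A - v A *m D);
  rewrite ?card_set_ord //.
- by move=> A; apply: vhomB => //; apply: vhom_mulmx.
- by rewrite vdiffB vdiff_mulmx uE -mulmxBl.
exists w => // A; apply/N_im; exists (v A).
by apply/eqP; rewrite -subr_eq0 addrAC wE.
Qed.

(** Elements of exterior degree zero are true cycles, so they already bound in the free module. *)
Lemma koszul_reg_bottom : koszul_reg deg N r 0.
Proof.
move=> d z rd hz z0 _.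
have [||A|B|w hw wz] := free_koszul_reg x0 deg_le (d := d) (z := z);
  rewrite ?card_set_ord //.
  by apply: vdiff_eq0 => x xB; apply: z0; rewrite cardsU1 xB.
exists w => // A; rewrite wz; apply/N_im; exists 0; by rewrite mul0mx.
Qed.

Lemma graded_ker : graded_submodule deg' (fun v => v *m D = 0).
Proof.
split=> [|d v vD]; last first.
  by rewrite -vproj_mulmx vD vproj_id //; apply: vhom0.
split=> [|u v uD vD|f u uD]; first exact: mul0mx.
  by rewrite mulmxDl uD vD addr0.
by rewrite -scalemxAl uD scaler0.
Qed.

End TwoModules.
End GradedModules.

(** * Finite generation of modules of bounded regularity *)

Section Generators.
Local Open Scope ring_scope.
Variables (K : fieldType) (s n : nat) (deg : 'I_n -> nat).
Local Notation S := {mpoly K[s]}.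
Implicit Types (u v : 'rV[S]_n) (N : 'rV[S]_n -> Prop) (L : seq 'rV[S]_n).

(** Defined as the intersection of all submodules containing [L]; explicit combinations come back by
    taking the submodule to be the row image of a matrix. *)
Definition spanned L u : Prop :=
  forall P, submodule P -> (forall x, x \in L -> P x) -> P u.

Lemma spanned_submodule L : submodule (spanned L).
Proof.
split=> [P [] //|u v uL vL P sP PL|f u uL P sP PL]; case: (sP) => _ PD PZ.
  by apply: PD; [apply: uL | apply: vL].
by apply: PZ; apply: uL.
Qed.

Lemma spanned_sub L L' u : {subset L <= L'} -> spanned L u -> spanned L' u.
Proof. by move=> LL uL P sP PL; apply: uL => // x /LL /PL. Qed.

Lemma mem_spanned L u : u \in L -> spanned L u.
Proof. by move=> uL P _; apply. Qed.

(* Finite-dimensionality: the entries of [l] are coordinates that separate the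
   points of the [K]-subspace [N]. *)
Lemma subspace_spanned (l : seq ('I_n * 'X_{1..s})) N :
  N 0 -> (forall u v, N u -> N v -> N (u + v)) ->
  (forall c u, N u -> N (c%:MP *: u)) ->
  (forall u, N u -> (forall p, p \in l -> (u 0 p.1)@_p.2 = 0) -> u = 0) ->
  exists2 L, forall x, x \in L -> N x & forall u, N u -> spanned L u.
Proof.
elim: l N => [|p l IH] N N0 ND NZ Nl.
  exists [::] => // u Nu; rewrite (Nl u Nu) //; by case: (spanned_submodule [::]).
(* The vectors with vanishing coordinate [p] form a subspace of codimension at most one, so at most
   one generator is added to theirs. *)
have [| | | |L LN NL] := IH (fun u => N u /\ (u 0 p.1)@_p.2 = 0).
- by rewrite mxE mcoeff0.
- by move=> u v [Nu u0] [Nv v0]; rewrite mxE mcoeffD u0 v0 addr0; split=> //; apply: ND.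
- by move=> c u [Nu u0]; rewrite mxE mcoeffCM u0 mulr0; split=> //; apply: NZ.
- move=> u [Nu u0] ul; apply: Nl => // q; rewrite inE => /orP[/eqP -> //|]; exact: ul.
have [[v [Nv v0]]|none] := classic (exists v, N v /\ (v 0 p.1)@_p.2 != 0); last first.
  exists L => [x /LN[] //|u Nu]; apply: NL; split=> //.
  by apply/eqP/negPn/negP => u0; apply: none; exists u.
exists (v :: L) => [x|u Nu]; first by rewrite inE => /orP[/eqP -> //|/LN[]].
pose c := (u 0 p.1)@_p.2 / (v 0 p.1)@_p.2.
have -> : u = (u + (- c)%:MP *: v) + c%:MP *: v.
  by rewrite -addrA -scalerDl -mpolyCD addNr mpolyC0 scale0r addr0.
have [_ sD sZ] := spanned_submodule (v :: L).
apply: sD; last by apply: sZ; apply: mem_spanned; apply: mem_head.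
apply: (@spanned_sub L); first by move=> x xL; rewrite inE xL orbT.
apply: NL; split; first by apply: ND => //; apply: NZ.
by rewrite !mxE mcoeffD mcoeffCM mulNr divfK // subrr.
Qed.

(** The degree [d] part embeds in the finite-dimensional space with coordinates the pairs of a basis
    index and a monomial of degree at most [d]. *)
Lemma hom_spanned N d : submodule N ->
  exists2 L, forall x, x \in L -> N x /\ vhom deg d x
           & forall u, N u -> vhom deg d u -> spanned L u.
Proof.
case=> N0 ND NZ.
pose l := [seq (b, bmnm m) | b <- enum 'I_n, m <- enum {: 'X_{1..s < d.+1}}].
have [| | | |L LN NL] := @subspace_spanned l (fun u => N u /\ vhom deg d u).
- by split=> //; apply: vhom0.
- move=> u v [Nu hu] [Nv hv]; split; first exact: ND.
  rewrite -(vproj_id hu) -(vproj_id hv) => b m.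
  rewrite mxE mcoeffD !mcoeff_vproj.
  by case: (_ =P d) => //; rewrite addr0 eqxx.
- move=> c u [Nu hu]; split=> [|b m]; first exact: NZ.
  by rewrite mxE mcoeffCM mulf_eq0 negb_or => /andP[_ /hu].
- move=> u [_ hu] ul; apply: row_mcoeffP => b m; rewrite mxE mcoeff0.
  apply/eqP/negPn/negP => nz; have md : (mdeg m < d.+1)%N by move: (hu _ _ nz); lia.
  move/eqP: nz; apply; apply: (ul (b, m)); apply/allpairsP.
  by exists (b, BMultinom md); split=> //; rewrite mem_enum.
by exists L => // u Nu hu; apply: NL.
Qed.

Lemma upto_spanned N R : submodule N ->
  exists2 L, forall x, x \in L -> N x /\ (exists2 d, (d <= R)%N & vhom deg d x)
           & forall d u, (d <= R)%N -> N u -> vhom deg d u -> spanned L u.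
Proof.
move=> sN; elim: R => [|R [L LN NL]].
  have [L LN NL] := hom_spanned 0 sN; exists L => [x /LN[Nx hx]|d u].
    by split=> //; exists 0%N.
  by rewrite leqn0 => /eqP ->; apply: NL.
have [L' LN' NL'] := hom_spanned R.+1 sN; exists (L' ++ L) => [x|d u].
  rewrite mem_cat => /orP[/LN'[Nx hx]|/LN[Nx [d dR hx]]]; split=> //.
    by exists R.+1.
  by exists d => //; apply: leqW.
rewrite leq_eqVlt ltnS => /orP[/eqP -> Nu hu|dR Nu hu].
  apply: (@spanned_sub L') (NL' u Nu hu) => x; by rewrite mem_cat => ->.
by apply: (@spanned_sub L) (NL d u dR Nu hu) => x; rewrite mem_cat orbC => ->.
Qed.

Lemma sum_vproj u : exists M, u = \sum_(d < M) vproj deg d u.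
Proof.
pose M := (\sum_(b : 'I_n) (msize (u 0%R b) + deg b)).+1; exists M.
apply: row_mcoeffP => b m; rewrite summxE raddf_sum /=.
have [uz|nz] := eqVneq (u 0 b)@_m 0.
  by rewrite uz big1 // => d _; rewrite mcoeff_vproj uz; case: ifP.
have mM : (mdeg m + deg b < M)%N.
  rewrite ltnS (bigD1 b) //=; apply: leq_trans (leq_addr _ _).
  by rewrite leq_add2r ltnW // msize_mdeg_lt // mcoeff_msupp.
rewrite (bigD1 (Ordinal mM)) //= mcoeff_vproj eqxx big1 ?addr0 // => d ne.
rewrite mcoeff_vproj; case: eqP => // E; case/eqP: ne.
by apply: val_inj; rewrite /= E.
Qed.

Lemma reg_spanned N r (x0 : 'I_s) :
  (forall b, (deg b <= r)%N) -> graded_submodule deg N -> koszul_reg deg N r s ->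
  exists2 L, forall x, x \in L -> N x /\ (exists2 d, (d <= r.+1)%N & vhom deg d x)
           & forall u, N u -> spanned L u.
Proof.
move=> hr [sN gN] reg; have [L LN NL] := upto_spanned r.+1 sN.
exists L => // u Nu.
have [M ->] := sum_vproj u; apply: submodule_sum => [|d _].
  exact: spanned_submodule.
move: (gN d u Nu) (@vproj_hom _ _ _ deg d u); move: (vproj deg d u) => {Nu}u; move: (nat_of_ord d) => {}d.
elim/ltn_ind: d u => d IH u Nu hu.
have [dr|rd] := leqP d r.+1; first exact: NL Nu hu.
(* A degree above [r.+1] has the form [d.+2] with [r <= d], and [koszul_reg_generators] then lowers
   it by one. *)
case: d => [//|[//|d]] in IH hu rd *.
have [v hv ->] := koszul_reg_generators x0 hr sN reg rd hu Nu.
apply: submodule_sum => [|x _]; first exact: spanned_submodule.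
have [_ _ sZ] := spanned_submodule L; have [Nv hvx] := hv x.
by apply: sZ; apply: (IH d.+1).
Qed.

End Generators.

(** * Minimal systems of homogeneous generators *)

Section MinimalGenerators.
Local Open Scope ring_scope.
Variables (K : fieldType) (s n : nat) (deg : 'I_n -> nat).
Local Notation S := {mpoly K[s]}.
Implicit Types (u : 'rV[S]_n) (N : 'rV[S]_n -> Prop).

Definition row_hom m (deg' : 'I_m -> nat) (D : 'M[S]_(m, n)) : Prop :=
  forall a b (k : 'X_{1..s}), (D a b)@_k != 0 -> (mdeg k + deg b)%N = deg' a.

Definition row_image m (D : 'M[S]_(m, n)) u : Prop := exists v, u = v *m D.

Lemma row_image_submodule m (D : 'M[S]_(m, n)) : submodule (row_image D).
Proof.
split=> [|u v [u' ->] [v' ->]|f u [u' ->]].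
- by exists 0; rewrite mul0mx.
- by exists (u' + v'); rewrite mulmxDl.
- by exists (f *: u'); rewrite scalemxAl.
Qed.

Lemma row_image_row m (D : 'M[S]_(m, n)) a : row_image D (row a D).
Proof. by exists (delta_mx 0 a); rewrite rowE. Qed.

Lemma row_image_sub m m' (D : 'M[S]_(m, n)) (D' : 'M[S]_(m', n)) u :
  (forall a, row_image D' (row a D)) -> row_image D u -> row_image D' u.
Proof.
move=> h [v ->]; rewrite mulmx_sum_row.
have [_ _ sZ] := row_image_submodule D'.
apply: submodule_sum => [|a _]; [exact: row_image_submodule | exact: sZ].
Qed.

(* A relation with a unit coefficient expresses one generator through the
   others; its component in the degree of that generator is still a relation. *)
Lemma drop_generator m (deg' : 'I_m.+1 -> nat) (D : 'M[S]_(m.+1, n)) (v : 'rV_m.+1) a :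
  row_hom deg' D -> v *m D = 0 -> (v 0 a)@_0%MM != 0 ->
  row_image (row' a D) (row a D).
Proof.
move=> hD vD nz; pose v' := vproj deg' (deg' a) v.
have vD' : v' *m D = 0.
  by rewrite -(vproj_mulmx hD) vD vproj_id //; apply: vhom0.
(* The entry at [a] of the component of degree [deg' a] has polynomial degree zero, so it is a
   scalar that can be inverted. *)
have vaE : v' 0 a = ((v 0 a)@_0%MM)%:MP.
  apply/mpolyP => k; rewrite mcoeff_vproj mcoeffC -{2}[deg' a]add0n eqn_add2r.
  by rewrite mdeg_eq0; case: eqP => [->|]; rewrite ?mulr1 ?mulr0.
move: vD'; rewrite mulmx_sum_row (bigD1_ord a) //= vaE => /eqP.
rewrite addr_eq0 => /eqP/(congr1 ( *:%R (((v 0 a)@_0%MM)^-1)%:MP)).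
rewrite scalerA -mpolyCM mulVf // mpolyC1 scale1r => ->.
have sub := row_image_submodule (row' a D); case: (sub) => s0 _ sZ.
apply: (sZ); rewrite -[X in row_image _ X]sub0r; apply: submoduleB => //.
apply: submodule_sum => // j _; apply: sZ.
have -> : row (lift a j) D = row j (row' a D) by apply/rowP => b; rewrite !mxE.
exact: row_image_row.
Qed.

(** Generators are discarded by [drop_generator] as long as some relation has a nonzero constant
    coefficient; this stops because their number decreases. *)
Lemma minimal_generators R m (deg' : 'I_m -> nat) (D : 'M[S]_(m, n)) :
  row_hom deg' D -> (forall a, (deg' a <= R)%N) ->
  exists m2 (deg2 : 'I_m2 -> nat) (D2 : 'M[S]_(m2, n)),
    [/\ row_hom deg2 D2, forall a, (deg2 a <= R)%N,
        forall u, row_image D u <-> row_image D2 u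
      & forall (v : 'rV_m2) a, v *m D2 = 0 -> (v 0 a)@_0%MM = 0].
Proof.
elim: m deg' D => [|m IH] deg' D hD hR.
  by exists 0%N, deg', D; split=> // v [].
have [[v [a [vD nz]]]|none] :=
  classic (exists (v : 'rV_m.+1) a, v *m D = 0 /\ (v 0 a)@_0%MM != 0); last first.
  exists m.+1, deg', D; split=> // v a vD; apply/eqP/negPn/negP => nz.
  by apply: none; exists v, a.
have [|//|m2 [deg2 [D2 [h1 h2 h3 h4]]]] := IH (fun j => deg' (lift a j)) (row' a D).
  by move=> j b k; rewrite mxE; apply: hD.
exists m2, deg2, D2; split=> // u; rewrite -h3; split; apply: row_image_sub => j.
  case: (unliftP a j) => [i ->|->]; last exact: drop_generator hD vD nz.
  have -> : row (lift a i) D = row i (row' a D) by apply/rowP => b; rewrite !mxE.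
  exact: row_image_row.
have -> : row j (row' a D) = row (lift a j) D by apply/rowP => b; rewrite !mxE.
exact: row_image_row.
Qed.

Definition minimal_presentation N r m (deg' : 'I_m -> nat) (D : 'M[S]_(m, n)) : Prop :=
  [/\ row_hom deg' D, forall a, (deg' a <= r)%N,
      forall u, N u <-> exists v, u = v *m D
    & forall (v : 'rV_m) a, v *m D = 0 -> (v 0 a)@_0%MM = 0].

(** Rank, degrees and matrix are bundled in one dependent pair so that a single choice can select
    them together. *)
Lemma minimal_presentation_exists N r (x0 : 'I_s) :
  (forall b, (deg b <= r)%N) -> graded_submodule deg N -> koszul_reg deg N r s ->
  exists x : {m : nat & (('I_m -> nat) * 'M[S]_(m, n))%type},
    minimal_presentation N r.+1 (projT2 x).1 (projT2 x).2.
Proof.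
move=> hr gN reg; have [L LN NL] := reg_spanned x0 hr gN reg.
pose D : 'M[S]_(size L, n) := \matrix_(i, j) (nth 0 L i) 0 j.
have rowD i : row i D = nth 0 L i by apply/rowP => j; rewrite !mxE.
have H (a : 'I_(size L)) : exists d, (d <= r.+1)%N /\ vhom deg d (row a D).
  have [_ [d dr hd]] := LN _ (mem_nth 0 (ltn_ord a)).
  by exists d; rewrite rowD.
have [deg' hdeg'] := fin_all_exists H.
have [|a|m2 [deg2 [D2 [h1 h2 h3 h4]]]] := @minimal_generators r.+1 _ deg' D.
- by move=> a b k; have := (hdeg' a).2 b k; rewrite mxE.
- by case: (hdeg' a).
exists (existT _ m2 (deg2, D2)); split=> // u; rewrite -[X in _ <-> X]/(row_image D2 u) -h3.
split=> [/NL|[v ->]].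
  apply; first exact: row_image_submodule.
  move=> x xL; have xi : (index x L < size L)%N by rewrite index_mem.
  by rewrite -(nth_index 0 xL) -(rowD (Ordinal xi)); apply: row_image_row.
rewrite mulmx_sum_row; case: gN => sN _; case: (sN) => _ _ NZ.
apply: submodule_sum => // i _; apply: NZ; rewrite rowD.
by have [] := LN _ (mem_nth 0 (ltn_ord i)).
Qed.

End MinimalGenerators.

(** * Ideals and monomials *)

Section IdealFacts.
Local Open Scope ring_scope.
Variables (K : fieldType) (s : nat).
Local Notation S := {mpoly K[s]}.
Implicit Types (I A : S -> Prop) (f g : S) (m : 'X_{1..s}).

Lemma ideal_sum I (T : Type) (r : seq T) (P : pred T) (F : T -> S) :
  is_ideal I -> (forall i, P i -> I (F i)) -> I (\sum_(i <- r | P i) F i).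
Proof. by case=> I0 ID _; apply: big_ind. Qed.

Lemma ideal_of_monomials I f :
  is_ideal I -> (forall m, f@_m != 0 -> I 'X_[m]) -> I f.
Proof.
move=> idI h; rewrite [f]mpolyE big_seq; apply: ideal_sum => // m.
by rewrite mcoeff_msupp => /h Im; rewrite -mul_mpolyC; case: idI => _ _; apply.
Qed.

Lemma ideal_gen_ideal A : is_ideal (ideal_gen A).
Proof.
split=> [|f g [lf Af ->] [lg Ag ->]|h f [l Al ->]].
- by exists [::]; rewrite ?big_nil.
- exists (lf ++ lg); last by rewrite big_cat.
  by move=> p; rewrite mem_cat => /orP[/Af|/Ag].
- exists [seq (h * p.1, p.2) | p <- l].
    by move=> p /mapP[q /Al Aq ->].
  by rewrite big_map mulr_sumr; apply: eq_bigr => p _; rewrite mulrA.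
Qed.

Lemma ideal_gen_mem A f : A f -> ideal_gen A f.
Proof.
move=> Af; exists [:: (1, f)]; last by rewrite big_seq1 mul1r.
by move=> p; rewrite inE => /eqP ->.
Qed.

Lemma colon_ideal I f : is_ideal I -> is_ideal (colon I f).
Proof.
case=> I0 ID IM; rewrite /colon; split=> [|g h Ig Ih|h g Ig].
- by rewrite mul0r.
- by rewrite mulrDl; apply: ID.
- by rewrite -mulrA; apply: IM.
Qed.

Lemma mpolyX_factor m x : (0 < m x)%N -> 'X_[m] = 'X_[m - U_(x)] * 'X_x :> S.
Proof. by move=> mx; rewrite -mpolyXD submK ?mnm1_le. Qed.

Lemma mnm_neq0 m : m != 0%MM -> exists x, (0 < m x)%N.
Proof.
move=> m0; apply: NNPP => none; case/eqP: m0; apply/mnmP => x.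
by rewrite mnm0E; apply/eqP/negPn/negP; rewrite -lt0n => mx; apply: none; exists x.
Qed.

Lemma irrelevant_idealP f : f@_0%MM = 0 -> irrelevant_ideal f.
Proof.
move=> f0; apply: ideal_of_monomials => [|m fm]; first exact: ideal_gen_ideal.
have [x mx] : exists x, (0 < m x)%N.
  by apply: mnm_neq0; apply: contra_neq fm => ->.
rewrite (mpolyX_factor mx); case: (@ideal_gen_ideal (fun f => exists i : 'I_s, f = 'X_i)).
by move=> _ _; apply; apply: ideal_gen_mem; exists x.
Qed.

End IdealFacts.

(** * The minimal graded resolution by iterated syzygies *)

Section Resolution.
Local Open Scope ring_scope.
Variables (K : fieldType) (s : nat).
Local Notation S := {mpoly K[s]}.

(* The submodule [st_N] of the free module with basis degrees [st_deg] is the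
   next syzygy module to be covered, and [st_r] bounds the regularity of the
   quotient. *)
Record stage := Stage {
  st_n : nat;
  st_deg : 'I_st_n -> nat;
  st_N : 'rV[S]_st_n -> Prop;
  st_r : nat }.

Arguments st_deg : clear implicits.
Arguments st_N : clear implicits.

(** The last clause places [st_N] inside the irrelevant ideal times the free module; it is what
    makes the differentials minimal. *)
Definition stage_ok st : Prop :=
  [/\ forall b, (st_deg st b <= st_r st)%N,
      graded_submodule (st_deg st) (st_N st),
      koszul_reg (st_deg st) (st_N st) (st_r st) s
    & forall u a, st_N st u -> (u 0 a)@_0%MM = 0].

(** The choice operator makes this total, so the stages are defined by plain recursion; the
    presentation property is guaranteed under [stage_ok]. *)
Definition st_next st : {m : nat & (('I_m -> nat) * 'M[S]_(m, st_n st))%type} :=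
  epsilon (inhabits (existT _ 0%N ((fun=> 0%N), 0)))
    (fun x => minimal_presentation (st_deg st) (st_N st) (st_r st).+1
                (projT2 x).1 (projT2 x).2).

Definition syzygy_stage st : stage :=
  Stage (projT2 (st_next st)).1 (fun v => v *m (projT2 (st_next st)).2 = 0)
    (st_r st).+1.

Variable x0 : 'I_s.

Lemma st_nextP st : stage_ok st ->
  minimal_presentation (st_deg st) (st_N st) (st_r st).+1
    (projT2 (st_next st)).1 (projT2 (st_next st)).2.
Proof.
case=> hr gN reg _; exact: (epsilon_spec _ _ (minimal_presentation_exists x0 hr gN reg)).
Qed.

Lemma syzygy_stage_ok st : stage_ok st -> stage_ok (syzygy_stage st).
Proof.
move=> ok; have [hom hr' im min] := st_nextP ok; case: ok => hr gN reg N0.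
split=> /=; [exact: hr' | exact: graded_ker hom | | by move=> u a; apply: min].
exact: (koszul_reg_ker hom x0 hr im reg).
Qed.

Variables (I : S -> Prop) (r : nat).

Definition first_stage : stage :=
  @Stage 1 (fun=> 0%N) (fun u => I (u 0 0)) r.

Fixpoint stages i : stage :=
  if i is i'.+1 then syzygy_stage (stages i') else first_stage.

Definition syzygy_resolution : graded_free_seq K s :=
  @GradedFreeSeq K s (fun i => st_n (stages i)) (fun i => st_deg (stages i))
    (fun i => (projT2 (st_next (stages i))).2) (const_mx 1).

Hypothesis ok0 : stage_ok first_stage.

Lemma stages_ok i : stage_ok (stages i).
Proof. by elim: i => // i; apply: syzygy_stage_ok. Qed.

Lemma st_r_stages i : st_r (stages i) = (i + r)%N.
Proof. by elim: i => //= i ->. Qed.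

Lemma syzygy_resolution_deg i (a : 'I_(gf_rank syzygy_resolution i)) :
  (gf_deg a <= i + r)%N.
Proof. by rewrite -st_r_stages; have [h _ _ _] := stages_ok i; apply: h. Qed.

Lemma syzygy_resolution_minimal : I 0 ->
  minimal_graded_free_resolution I syzygy_resolution.
Proof.
move=> I0; have P i := st_nextP (stages_ok i).
split.
- split=> [i a b|a]; last by rewrite mxE; apply: dhomog1.
  have [hom _ _ _] := P i.
  have [->|nz] := eqVneq (gf_diff syzygy_resolution i a b) 0; first by left.
  (* The degree of a nonzero entry is read off its leading monomial. *)
  right; have m0 : (gf_diff syzygy_resolution i a b)@_(mlead (gf_diff syzygy_resolution i a b)) != 0.
    by rewrite -mcoeff_msupp mlead_supp.
  exists (mdeg (mlead (gf_diff syzygy_resolution i a b))); last first.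
    by rewrite addnC; apply/esym; apply: hom m0.
  apply/dhomog_coeffP => k /hom E; have := hom _ _ _ m0.
  by rewrite -E => /addIn.
- have augE (u : 'rV[S]_1) : (u *m gf_aug syzygy_resolution) 0 0 = u 0 0.
    by rewrite mxE big_ord1 mxE mulr1.
  split=> [f|u|i u].
  + by exists (const_mx f); rewrite augE mxE subrr.
  + by rewrite augE; have [_ _ im _] := P 0%N; apply: (im u).
  + by have [_ _ im _] := P i.+1; apply: (im u).
- move=> i a b; apply: irrelevant_idealP.
  have [_ _ im _] := P i; have [_ _ _ N0] := stages_ok i.
  have := N0 (row a (gf_diff syzygy_resolution i)) b; rewrite mxE; apply.
  by apply/im; exists (delta_mx 0 a); rewrite rowE.
Qed.

(** Induction on the cut-off [p] for all stages at once: each unit of exterior degree is traded for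
    one further stage until [koszul_reg_bottom] applies. The cut-off [s] excludes no set of
    variables. *)
Lemma syzygy_resolution_reg q :
  (forall i (a : 'I_(gf_rank syzygy_resolution i)), (gf_deg a <= i + q)%N) ->
  koszul_reg (st_deg first_stage) (st_N first_stage) q s.
Proof.
move=> hq; suff H p i : koszul_reg (st_deg (stages i)) (st_N (stages i)) (i + q) p.
  exact: (H s 0%N).
elim: p i => [|p IH] i; have [hom _ im _] := st_nextP (stages_ok i).
  exact: koszul_reg_bottom x0 (hq i) im.
by apply: (koszul_reg_coker hom x0 (hq i) im); apply: (IH i.+1).
Qed.

End Resolution.

(** * Koszul homology and colon ideals of edge ideals *)

Section EdgeIdeal.
Local Open Scope ring_scope.
Variables (K : fieldType) (s : nat) (e : rel 'I_s).
Hypotheses (e_sym : ssrbool.symmetric e) (e_irr : irreflexive e).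
Local Notation S := {mpoly K[s]}.
Implicit Types (f g : S) (m : 'X_{1..s}).

Definition msupport m : {set 'I_s} := [set x | (0 < m x)%N].

(** The Stanley-Reisner description: monomials with stable support form a basis of the quotient. It
    turns membership into a condition on coefficients. *)
Lemma edge_idealP f :
  edge_ideal K e f <-> forall m, stable e (msupport m) -> f@_m = 0.
Proof.
split=> [[l le ->] m sm|h].
  rewrite raddf_sum /= big_seq big1 // => p /le[i [j [eij ->]]].
  apply/eqP/negPn/negP; rewrite -mpolyXD => /mcoeffM_neq0[m1 [m2 [_]]].
  rewrite mcoeffX; case: (_ =P m2) => [<- _ mE|_]; last by rewrite eqxx.
  have /forall_inP/(_ i) := sm; rewrite inE mE !mnmDE !mnm1E eqxx addnCA.
  move=> /(_ isT)/forall_inP/(_ j); rewrite inE !mnmDE !mnm1E eqxx !addnA addn1.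
  by rewrite eij => /(_ isT).
apply: ideal_of_monomials => [|m fm]; first exact: ideal_gen_ideal.
have : ~~ stable e (msupport m) by apply: contra_neqN fm => /h.
rewrite negb_forall_in => /exists_inP[i]; rewrite inE => mi.
rewrite negb_forall_in => /exists_inP[j]; rewrite inE negbK => mj eij.
have [_ _ IM] := @ideal_gen_ideal K s (fun f => exists i j : 'I_s, e i j /\ f = 'X_i * 'X_j :> S).
have ij : i != j by apply: contraTneq eij => ->; rewrite e_irr.
have mij : (0 < (m - U_(i))%MM j)%N by rewrite mnmBE mnm1E (negPf ij) subn0.
rewrite (mpolyX_factor _ mi) (mpolyX_factor _ mij) -mulrA; apply: IM.
by apply: ideal_gen_mem; exists j, i; rewrite e_sym.
Qed.

Definition deg0 : 'I_1 -> nat := fun=> 0%N.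
Definition edge_submodule (u : 'rV[S]_1) : Prop := edge_ideal K e (u 0 0).

Lemma edge_submodule_graded : graded_submodule deg0 edge_submodule.
Proof.
have [I0 ID IM] : is_ideal (edge_ideal K e) by apply: ideal_gen_ideal.
split=> [|d u /edge_idealP uI].
  by split=> [|u v|f u]; rewrite /edge_submodule mxE //; [apply: ID | apply: IM].
apply/edge_idealP => m sm; rewrite mcoeff_vproj uI //; by case: ifP.
Qed.

Lemma edge_submodule_irrelevant u a : edge_submodule u -> (u 0 a)@_0%MM = 0.
Proof.
rewrite [a]ord1 => /edge_idealP; apply; apply/forall_inP => x.
by rewrite inE mnm0E.
Qed.

(* A stable support has at most two elements, so a monomial of degree at least
   three outside the ideal has an exponent at least two, which serves as a pivot. *)
Lemma edge_koszul_reg (x0 : 'I_s) :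
  (forall A, stable e A -> (#|A| <= 2)%N) ->
  koszul_reg deg0 edge_submodule 2 s.
Proof.
move=> e2 d z d2 hz _ cz.
pose pivot (m : 'X_{1..s}) := odflt x0 [pick x | (1 < m x)%N].
have [||B m sm|w hw wz] := @koszul_contraction K s (fun m => stable e (msupport m))
    pivot d (fun A => z A 0 0).
- by move=> A; apply/dhomog_coeffP => m /hz; rewrite addn0.
- move=> m A md sm.
  (* If all exponents of the multidegree were at most one, [m] would be squarefree with stable
     support, hence of degree at most two. *)
  have mp : (1 < kmonom m A (pivot (kmonom m A)))%N.
    rewrite /pivot; case: pickP => //= none.
    suff : (mdeg m <= 2)%N by rewrite md; lia.
    apply: leq_trans (e2 _ sm); rewrite mdegE -sum1_card [X in (_ <= X)%N]big_mkcond /=.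
    apply: leq_sum => i _; have := none i; rewrite inE mnmDE.
    by case: (m i) => [|[|k]].
  split=> [|xA]; first exact: ltnW.
  (* The pivot has exponent at least two and [A] accounts for only one, so it already divides [m]
     and multiplying by it keeps the support. *)
  congr (stable e _): sm; apply/setP => y; rewrite !inE mnmDE mnm1E.
  case: eqP => [<-|_]; last by rewrite addn0.
  by move: mp; rewrite mnmDE mnmE xA; lia.
- by have /edge_idealP := cz B; rewrite mxE; apply.
exists (fun A => const_mx (w A)) => [A b m|A].
  by rewrite mxE addn0; move/dhomog_coeffP: (hw A); apply.
apply/edge_idealP => m sm; rewrite !mxE.
rewrite (_ : kdiff _ A = kdiff w A) ?wz //.
by apply: eq_kdiff => B; rewrite mxE.
Qed.

Lemma msupportD m m' : msupport (m + m')%MM = msupport m :|: msupport m'.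
Proof. by apply/setP => x; rewrite !inE mnmDE addn_gt0. Qed.

Lemma msupport1 x : msupport U_(x)%MM = [set x].
Proof. by apply/setP => y; rewrite !inE mnm1E eq_sym; case: eqP. Qed.

(* In the squarefree multidegree of all the variables, a Koszul boundary of
   [w] has, at the complement of [{u, v}], the coefficient of a coboundary on
   the independence complex. *)
Lemma squarefree_boundary (w : {set 'I_s} -> S) (u v : 'I_s) : u != v ->
  exists k, (kdiff w (~: [set u; v]))@_(U_(u) + U_(v)) =
    (-1) ^+ k * ((-1) ^+ ksign v (~: [set v]) * (w (~: [set v]))@_(U_(v))
               - (-1) ^+ ksign u (~: [set u]) * (w (~: [set u]))@_(U_(u))).
Proof.
move=> uv; pose A := ~: [set u; v].
have vA : v \notin A by rewrite !inE eqxx orbT.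
have uA : u \notin A by rewrite !inE eqxx.
have uE : u |: A = ~: [set v].
  by apply/setP => x; rewrite !inE; case: (eqVneq x u) => [->|] //=; rewrite uv.
have vE : v |: A = ~: [set u].
  apply/setP => x; rewrite !inE; case: (eqVneq x v) => [->|_] /=; last by rewrite orbF.
  by rewrite eq_sym uv.
rewrite mcoeff_kdiff (bigD1 u) /=; last by rewrite uA mnmDE mnm1E eqxx.
rewrite (bigD1 v) /=; last by rewrite vA mnmDE !mnm1E eqxx addn1 /= eq_sym.
rewrite big1 ?addr0 => [|x /andP[/andP[/andP[xA _] xu] xv]]; last first.
  by move: xA; rewrite /A !inE negbK (negPf xu) (negPf xv).
rewrite uE vE addmK [(U_(u) + U_(v))%MM]addmC addmK.
have kv : ksign v (~: [set v]) = (ksign v A + (u < v))%N by rewrite -uE ksignU1.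
have ku : ksign u (~: [set u]) = (ksign u A + (v < u))%N by rewrite -vE ksignU1.
have sgE i j : odd i = odd j -> (-1) ^+ i = (-1) ^+ j :> K.
  by move=> h; rewrite -[LHS]signr_odd h signr_odd.
(* Exactly one of [u < v] and [v < u] holds, whence the relative minus sign. *)
exists (ksign u A + ksign v A + (u < v))%N; rewrite kv ku.
have sN i : - (-1) ^+ i = (-1) ^+ i.+1 :> K by rewrite exprS mulN1r.
rewrite mulrBr !mulrA -!exprD -mulNr sN.
have uv' : nat_of_ord u != v by [].
by congr (_ * _ + _ * _); apply: sgE; rewrite /= !oddD; case: ltngtP uv' => //;
  case: odd; case: odd.
Qed.

(* [e_{V - ab} X_a X_b] is a Koszul cycle modulo the ideal because no three
   vertices are stable; it bounds only if [ab] is a bridge of the complement. *)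
Lemma edge_koszul_not_reg (a b : 'I_s) :
  (forall A, stable e A -> (#|A| <= 2)%N) -> a != b -> ~~ e a b ->
  (forall f : 'I_s -> K,
     (forall u v, u != v -> ~~ e u v -> [set u; v] != [set a; b] -> f u = f v) ->
     f a = f b) ->
  ~ koszul_reg deg0 edge_submodule 1 s.
Proof.
move=> e2 ab eab conn reg.
have st2 u v : ~~ e u v -> stable e [set u; v].
  move=> uv; apply/forall_inP => x; rewrite !inE => xuv; apply/forall_inP => y; rewrite !inE.
  by move: xuv => /orP[] /eqP -> /orP[] /eqP ->; rewrite ?e_irr // e_sym.
pose c (A : {set 'I_s}) : S := if A == ~: [set a; b] then 'X_a * 'X_b else 0.
have c0 A m : (c A)@_m != 0 -> A = ~: [set a; b] /\ m = (U_(a) + U_(b))%MM.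
  rewrite /c; case: (A =P _) => [->|_]; last by rewrite mcoeff0 eqxx.
  by rewrite -mpolyXD mcoeffX; case: (_ =P m) => [->|] //; rewrite eqxx.
have [||A|B|w hw wz] := reg 1%N (fun A => const_mx (c A)) => //.
- move=> A i m; rewrite mxE => /c0[_ ->].
  by rewrite mdegD !mdeg1.
- by rewrite card_set_ord.
(* A monomial of the boundary is [X_a X_b X_x] with a third vertex [x], and its support is not
   stable. *)
- apply/edge_idealP => m sm; rewrite mxE; apply/eqP/negPn/negP.
  rewrite (eq_kdiff (c' := c)) => [|A]; last by rewrite mxE.
  rewrite mcoeff_kdiff big1 ?eqxx // => x /andP[xB mx].
  apply/eqP; rewrite mulf_eq0 signr_eq0 /=; apply/negPn/negP => /c0[BE mE].
  have : x \notin [set a; b] by rewrite -in_setC -BE setU11.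
  have := e2 _ sm; rewrite -(submK (mnm1_le mx)) mE !msupportD !msupport1.
  by rewrite setUC cardsU1 cards2 ab => + xab; rewrite xab.
pose w0 (A : {set 'I_s}) : S := w A 0 0.
have bd u v : u != v -> ~~ e u v ->
    (c (~: [set u; v]))@_(U_(u) + U_(v)) = (kdiff w0 (~: [set u; v]))@_(U_(u) + U_(v)).
  move=> uv euv; apply/eqP; rewrite -subr_eq0 -mcoeffB; apply/eqP.
  have /edge_idealP/(_ (U_(u) + U_(v))%MM) := wz (~: [set u; v]).
  rewrite !mxE; apply; rewrite msupportD !msupport1; exact: st2.
(* For this signed coefficient of [w], the boundary equation at any non-adjacent pair other than
   [ab] equates its two values. Equal values at [a] and [b] then contradict the coefficient one of
   [X_a X_b]. *)
have fab := conn (fun v => (-1) ^+ ksign v (~: [set v]) * (w0 (~: [set v]))@_(U_(v))).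
have := bd a b ab eab; have [k ->] := squarefree_boundary w0 ab.
rewrite fab ?subrr ?mulr0 => [|u v uv euv neq].
  by rewrite /c eqxx -mpolyXD mcoeffX eqxx => /eqP; rewrite oner_eq0.
have := bd u v uv euv; have [l ->] := squarefree_boundary w0 uv.
rewrite /c (inj_eq (@setC_inj _)) (negPf neq) mcoeff0 => /esym/eqP.
by rewrite mulf_eq0 signr_eq0 /= subr_eq0 => /eqP ->.
Qed.

(** The colon ideal is the kernel of the substitution [phi] that keeps [X_a] and [X_b] and kills the
    other variables, and [phi] takes values in a domain. *)
Lemma edge_colon_prime (a b : 'I_s) : a != b -> ~~ e a b ->
  (forall z, z != a -> z != b -> e z a \/ e z b) ->
  is_prime_ideal (colon (edge_ideal K e) ('X_a * 'X_b)).
Proof.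
move=> ab eab cover; set J := colon _ _.
have idI : is_ideal (edge_ideal K e) by apply: ideal_gen_ideal.
have idJ : is_ideal J := colon_ideal _ idI.
have [J0 JD JM] := idJ.
pose t := [tuple (if (i == a) || (i == b) then 'X_i else 0 : S) | i < s].
have X0 i : ('X_i == 0 :> S) = false.
  by apply/eqP => /mpolyP/(_ U_(i)%MM)/eqP; rewrite mcoeffX mcoeff0 eqxx oner_eq0.
pose phi := comp_mpoly t.
have phiX i : phi 'X_i = if (i == a) || (i == b) then 'X_i else 0.
  by rewrite /phi comp_mpolyXU -tnth_nth tnth_mktuple.
have phiI f : edge_ideal K e f -> phi f = 0.
  case=> l le ->; rewrite /phi raddf_sum /= big_seq big1 // => p /le[i [j [eij ->]]].
  rewrite !rmorphM /= -/phi !phiX.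
  have [ia|_] /= := eqVneq i a; last have [ib|_] /= := eqVneq i b.
  - have [ja|_] /= := eqVneq j a; first by rewrite ia ja e_irr in eij.
    have [jb|_] /= := eqVneq j b; first by rewrite ia jb (negPf eab) in eij.
    by rewrite !mulr0.
  - have [ja|_] /= := eqVneq j a; first by rewrite ib ja e_sym (negPf eab) in eij.
    have [jb|_] /= := eqVneq j b; first by rewrite ib jb e_irr in eij.
    by rewrite !mulr0.
  - by rewrite mul0r mulr0.
have JX z : z != a -> z != b -> J 'X_z.
  move=> za zb; rewrite /J /colon; have [_ _ IM] := idI.
  case: (cover z za zb) => ez; [rewrite mulrA mulrC | rewrite mulrCA];
    by apply: IM; apply: ideal_gen_mem; exists z; eexists; split; first exact: ez.
(* Each monomial is either fixed by [phi] or divisible by a variable other than [X_a] and [X_b],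
   which lies in [J]. *)
have Jphi f : J (f - phi f).
  rewrite /phi comp_mpolyEX {1}[f]mpolyE -sumrB.
  apply: ideal_sum => // m _; rewrite -scalerBr -mul_mpolyC; apply: (JM).
  have [/existsP[z /and3P[za zb mz]]|/existsPn none] :=
      boolP [exists z, [&& z != a, z != b & (0 < m z)%N]].
    rewrite (mpolyX_factor _ mz) rmorphM /= -/phi phiX (negPf za) (negPf zb) mulr0 subr0.
    by apply: JM; apply: JX.
  rewrite comp_mpolyX mpolyXE_id.
  rewrite [X in _ - X](eq_bigr (fun i => 'X_i ^+ m i)) ?subrr // => i _.
  rewrite tnth_mktuple; case: ifP => // /norP[ia ib].
  by have := none i; rewrite ia ib /= -leqNgt leqn0 => /eqP ->; rewrite !expr0.
have JP f : J f <-> phi f = 0.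
  split=> [Jf|pf]; last by have := Jphi f; rewrite pf subr0.
  have /eqP := phiI _ Jf; rewrite /phi !rmorphM /= -/phi !phiX !eqxx orbT.
  by rewrite !mulf_eq0 !X0 ?orbF => /eqP.
split=> // [/JP|f g /JP]; first by rewrite /phi rmorph1 => /eqP; rewrite oner_eq0.
rewrite /phi rmorphM /= => /eqP; rewrite mulf_eq0 -/phi.
by case/orP => /eqP /JP; [left | right].
Qed.

End EdgeIdeal.

(** * Combinatorics of the complement graph and the class [W_2] *)

Section Complement.
Variables (T : finType) (e : rel T).
Hypotheses (e_sym : ssrbool.symmetric e) (e_irr : irreflexive e).
Hypotheses (e_crit : edge_critical e) (e_noiso : no_isolated e).
Hypothesis e_beta : beta0 e = 2.

Definition coadj x y := (x != y) && ~~ e x y.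

Lemma coadj_sym x y : coadj x y = coadj y x.
Proof. by rewrite /coadj eq_sym e_sym. Qed.

Lemma stable_card A : stable e A -> (#|A| <= 2)%N.
Proof. by move=> sA; rewrite -e_beta /beta0; apply: leq_bigmax_cond. Qed.

Lemma stable_pair x y : ~~ e x y -> stable e [set x; y].
Proof.
move=> xy; apply/forall_inP => u; rewrite !inE => xu; apply/forall_inP => v; rewrite !inE.
by move: xu => /orP[] /eqP -> /orP[] /eqP ->; rewrite ?e_irr // e_sym.
Qed.

Lemma coadj_max_stable x y : coadj x y -> max_stable e [set x; y].
Proof. by case/andP=> xy exy; rewrite /max_stable stable_pair // cards2 xy e_beta. Qed.

Lemma coadj_triangle x y z : coadj x y -> coadj y z -> coadj x z -> False.
Proof.
move=> /andP[xy exy] /andP[yz eyz] /andP[xz exz].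
have : stable e [set x; y; z].
  apply/forall_inP => u; rewrite !inE => xu; apply/forall_inP => v; rewrite !inE.
  by move: xu => /orP[/orP[]|] /eqP -> /orP[/orP[]|] /eqP ->;
    rewrite ?e_irr // ?exy ?eyz ?exz // e_sym.
move/stable_card; rewrite setUC cardsU1 cards2 xy !inE negb_or.
by rewrite ![z == _]eq_sym xz yz.
Qed.

(** A stable set of three or more vertices appears when the edge is deleted. It must contain both
    ends, since otherwise it was stable before, and any third element is the required [z]. *)
Lemma edge_coadj x y : e x y -> exists2 z, coadj z x & coadj z y.
Proof.
move=> exy; have := e_crit exy; rewrite /critical e_beta => b3.
have [A sA cA] : exists2 A, stable (del_edge e x y) A & (2 < #|A|)%N.
  apply: NNPP => none; move: b3; rewrite ltnNge => /negP; apply.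
  apply/bigmax_leqP => A sA; rewrite leqNgt; apply/negP => cA.
  by apply: none; exists A.
have stA u v : u \in A -> v \in A -> e u v -> (u == x) && (v == y) || (u == y) && (v == x).
  move=> uA vA euv; have /forall_inP/(_ u uA)/forall_inP/(_ v vA) := sA.
  by rewrite /del_edge /= euv /= negbK.
have xyA : (x \in A) && (y \in A).
  apply/negPn/negP => nxy; suff /stable_card : stable e A by rewrite leqNgt cA.
  apply/forall_inP => u uA; apply/forall_inP => v vA; apply/negP => /(stA u v uA vA).
  by case/orP => /andP[/eqP ux /eqP vy]; move: nxy; rewrite -ux -vy uA vA.
have [xA yA] := andP xyA.
have [z /setDP[zA]] : exists z, z \in A :\: [set x; y].
  apply/set0Pn; rewrite -cards_eq0 -lt0n cardsD subn_gt0.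
  by apply: leq_ltn_trans (subset_leq_card (subsetIr _ _)) (leq_ltn_trans _ cA); rewrite cards2; case: eqP.
rewrite !inE negb_or => /andP[zx zy].
exists z; rewrite /coadj ?zx ?zy /=; apply/negP => /stA;
  by rewrite zA (negPf zx) (negPf zy) /= => /(_ isT); rewrite ?xA ?yA => /(_ isT).
Qed.

(** Criticality at an edge through [x] gives one co-neighbour. If it is [c], take an edge from [c]
    to [w']: either [w'] is itself a co-neighbour of [x], or [x] and [w'] are adjacent and have a
    common co-neighbour, distinct from [c]. *)
Lemma coadj_other x c : exists2 y, coadj x y & y != c.
Proof.
have [w exw] := e_noiso x; have [z zx _] := edge_coadj exw.
have [zc|zc] := eqVneq z c; last by exists z; rewrite // coadj_sym.
rewrite {z}zc in zx; have [w' ecw] := e_noiso c.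
have [exw'|exw'] := boolP (e x w').
  have [z' z'x z'w] := edge_coadj exw'; exists z'; first by rewrite coadj_sym.
  by apply: contraTneq z'w => ->; rewrite /coadj ecw andbF.
exists w'; last by apply: contraTneq ecw => ->; rewrite e_irr.
rewrite /coadj exw' andbT; apply: contraTneq ecw => <-.
by case/andP: zx.
Qed.

(** If [A] contains a co-neighbour [c] of [x], another co-neighbour of [x] in [A] would form a
    triangle of the complement with [x] and [c]. *)
Lemma coadj_escape A x : stable e A -> exists2 y, coadj x y & y \notin A.
Proof.
move=> sA; have stA u v : u \in A -> v \in A -> ~~ e u v.
  by move=> uA vA; have /forall_inP/(_ u uA)/forall_inP/(_ v vA) := sA.
have [/existsP[c /andP[cA xc]]|/existsPn none] := boolP [exists c, (c \in A) && coadj x c].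
  have [y xy yc] := coadj_other x c; exists y => //; apply/negP => yA.
  by apply: (@coadj_triangle x y c) => //; rewrite /coadj yc stA.
have [y xy _] := coadj_other x x; exists y => //.
by have := none y; rewrite xy andbT.
Qed.

Lemma vertex_exists : exists x : T, true.
Proof.
apply: NNPP => none; have := e_beta; rewrite /beta0 big1 // => A _.
by apply/eqP; rewrite cards_eq0; apply/set0Pn => -[x _]; apply: none; exists x.
Qed.

Lemma card_ge2 : (2 <= #|T|)%N.
Proof.
have [x _] := vertex_exists; have [y /andP[xy _] _] := coadj_other x x.
by have := max_card [set x; y]; rewrite cards2 xy.
Qed.

(** With fewer than two elements, [A] extends to an edge of the complement whose new ends avoid [B]
    by [coadj_escape]; with two it is already maximum. Applying this to [A] against [B], then to [B]
    against the enlarged [A'], gives [W_2]. *)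
Lemma extend_stable A B : stable e A -> stable e B -> [disjoint A & B] ->
  exists A', [/\ max_stable e A', A \subset A' & [disjoint A' & B]].
Proof.
move=> sA sB dAB.
have ext x : x \notin B -> A \subset [set x] ->
    exists A', [/\ max_stable e A', A \subset A' & [disjoint A' & B]].
  move=> xB Ax; have [y xy yB] := coadj_escape x sB.
  exists [set x; y]; split; first exact: coadj_max_stable.
    by apply: subset_trans Ax _; rewrite sub1set !inE eqxx.
  rewrite disjoints_subset; apply/subsetP => z; rewrite !inE.
  by case/orP => /eqP ->.
have [a0|[x xA]] := set_0Vmem A.
  have [x _] := vertex_exists; have [y _ yB] := coadj_escape x sB.
  by apply: (ext y); rewrite // a0 sub0set.
have xB : x \notin B by move/disjointFr: dAB => ->.
have [Ax|/subsetPn[y yA]] := boolP (A \subset [set x]); first exact: ext xB Ax.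
rewrite inE => yx; exists A; split=> //; rewrite /max_stable sA /= e_beta eqn_leq.
rewrite stable_card //=; have <- : #|[set x; y]| = 2 by rewrite cards2 eq_sym yx.
by apply/subset_leq_card/subsetP => z; rewrite !inE => /orP[] /eqP ->.
Qed.

Lemma complement_in_W2 : in_W2 e.
Proof.
split=> [|A B sA sB dAB]; first exact: card_ge2.
have [A' [mA AA dA]] := extend_stable sA sB dAB.
have sA' : stable e A' by case/andP: mA.
have [|B' [mB BB dB]] := extend_stable sB sA'; first by rewrite disjoint_sym.
by exists A', B'; split=> //; rewrite disjoint_sym.
Qed.

(* An edge [ab] of the complement lies on a cycle of length four or five. *)
Lemma coadj_not_bridge (R : Type) (f : T -> R) a b : coadj a b ->
  (forall u v, u != v -> ~~ e u v -> [set u; v] != [set a; b] -> f u = f v) ->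
  f a = f b.
Proof.
move=> ab fE.
have step u v : coadj u v -> ~~ ((u \in [set a; b]) && (v \in [set a; b])) -> f u = f v.
  move=> /andP[uv euv] nab; apply: fE => //; apply: contra nab => /eqP <-.
  by rewrite !inE !eqxx orbT.
have [c ac cb] := coadj_other a b; have [d bd da] := coadj_other b a.
have ca : c != a by case/andP: ac; rewrite eq_sym.
have db : d != b by case/andP: bd; rewrite eq_sym.
have -> : f a = f c by apply: step; rewrite // !inE (negPf ca) (negPf cb) andbF.
have -> : f b = f d by apply: step; rewrite // !inE (negPf da) (negPf db) andbF.
have [-> //|cd] := eqVneq c d.
(* If [c] and [d] are co-adjacent, they close a cycle of length four with [ab]; otherwise a common
   co-neighbour [z] closes one of length five. *)
have [ecd|ecd] := boolP (e c d); last first.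
  apply: fE => //; apply: contraNneq ca => E.
  by have := set21 c d; rewrite E !inE (negPf cb) orbF.
have [z zc zd] := edge_coadj ecd.
have -> : f c = f z.
  by apply: step; rewrite 1?coadj_sym // !inE (negPf ca) (negPf cb).
by apply: step; rewrite // !inE (negPf da) (negPf db) andbF.
Qed.

End Complement.

(** * The v-number and the regularity *)

Section Invariants.
Variables (K : fieldType) (s : nat) (e : rel 'I_s).
Hypotheses (e_sym : ssrbool.symmetric e) (e_irr : irreflexive e).
Hypotheses (e_crit : edge_critical e) (e_noiso : no_isolated e).
Hypothesis e_beta : beta0 e = 2.
Local Open Scope ring_scope.

Let other := coadj_other e_sym e_irr e_crit e_noiso e_beta.
Let triangle := coadj_triangle e_sym e_irr e_beta.

Lemma edge_ideal_v_number : is_v_number (edge_ideal K e) 2.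
Proof.
have [a _] := vertex_exists e_beta.
have [b ab _] := other a a; have [anb eab] := andP ab.
have idI : is_ideal (edge_ideal K e) by apply: ideal_gen_ideal.
have [I0 _ IM] := idI.
split.
  split=> //; exists ('X_a * 'X_b), (colon (edge_ideal K e) ('X_a * 'X_b)).
  have P : is_prime_ideal (colon (edge_ideal K e) ('X_a * 'X_b)).
    apply: edge_colon_prime => // z za zb; apply: NNPP => none.
    apply: (triangle (x := z) (y := a) (z := b)) => //; rewrite /coadj ?za ?zb;
      by apply/negP => ez; apply: none; auto.
  split=> //; last by split=> //; exists ('X_a * 'X_b).
  by rewrite -mpolyXD dhomogX /= mdegD !mdeg1.
move=> d [d1 [f [P [hf [Pprime _] fP]]]]; rewrite leqNgt; apply/negP => d2.
have {d1 d2} dE : d = 1%N by lia.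
have [_ P1 PM] := Pprime.
have [f0|fn0] := eqVneq f 0.
  by apply: P1; apply/fP; rewrite /colon f0 mulr0.
have : mlead f \in msupp f by apply: mlead_supp.
move: (mlead f) => m; rewrite mcoeff_msupp => fm.
have /eqP/mdeg1P[x /eqP mE] : mdeg m = 1%N by rewrite -dE; move/dhomog_coeffP: hf; apply.
have [y xy _] := other x x; have [z xz zy] := other x y.
(* The coefficient of [X_u f] at [X_u X_x] is that of [f] at [X_x], which is nonzero, and [u], [x]
   form a stable pair. *)
have notP u : coadj e x u -> ~ P 'X_u.
  move=> xu /fP /(edge_idealP e_sym e_irr)/(_ (U_(u) + U_(x))%MM).
  rewrite mulrC mcoeffMX -mE => H; case/eqP: fm; apply: H.
  by rewrite mE msupportD !msupport1 stable_pair // e_sym; case/andP: xu.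
have : P ('X_y * 'X_z).
  apply/fP; rewrite /colon mulrC; apply: IM; apply: ideal_gen_mem; exists y, z; split=> //.
  apply/negPn/negP => yz; apply: (triangle (x := x) (y := y) (z := z)) => //.
  by rewrite /coadj eq_sym zy.
by case/PM; apply: notP.
Qed.

Lemma edge_ideal_regularity : is_regularity (edge_ideal K e) 2%:Z.
Proof.
have [a _] := vertex_exists e_beta.
have [b ab _] := other a a; have [anb eab] := andP ab.
have [I0 _ _] : is_ideal (edge_ideal K e) by apply: ideal_gen_ideal.
have st2 := stable_card e_beta.
have ok : stage_ok (first_stage (edge_ideal K e) 2).
  split=> //=.
  - exact: edge_submodule_graded.
  - exact: edge_koszul_reg.
  - by move=> u i; apply: edge_submodule_irrelevant.
pose F := syzygy_resolution (edge_ideal K e) 2.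
have Fdeg i (c : 'I_(gf_rank F i)) : (gf_deg c <= i + 2)%N := syzygy_resolution_deg a ok c.
have bettiP i j : gf_betti F i j <> 0%N -> exists c : 'I_(gf_rank F i), gf_deg c = j.
  by move/eqP; rewrite cards_eq0 => /set0Pn[c]; rewrite inE => /eqP; exists c.
exists (gf_betti F); first by exists F => //; apply: (syzygy_resolution_minimal a).
split=> [|i j /bettiP[c <-]]; last by have := Fdeg i c; lia.
(* If all generators of each [F_i] had degree at most [i + 1], the quotient would be 1-regular,
   against the Koszul class of [edge_koszul_not_reg]. *)
have [i [c ci]] : exists i (c : 'I_(gf_rank F i)), (i + 1 < gf_deg c)%N.
  apply: NNPP => none.
  apply: (@edge_koszul_not_reg K s e e_sym e_irr a b st2 anb eab).
    by move=> f; apply: coadj_not_bridge ab.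
  apply: (syzygy_resolution_reg a ok (q := 1)) => i c.
  by rewrite leqNgt; apply/negP => ci; apply: none; exists i, c.
exists i, (gf_deg c); split; last by have := Fdeg i c; lia.
by apply/eqP; rewrite cards_eq0; apply/set0Pn; exists c; rewrite inE.
Qed.

End Invariants.

Theorem corollary4p20 (K : fieldType) (s : nat) (e : rel 'I_s)
    (e_sym : ssrbool.symmetric e) (e_irr : irreflexive e)
    (e_crit : edge_critical e) (e_noiso : no_isolated e)
    (e_beta : beta0 e = 2) :
  in_W2 e /\ is_v_number (edge_ideal K e) 2 /\
  is_regularity (edge_ideal K e) 2%:Z.
Proof.
split; first exact: complement_in_W2.
by split; [apply: edge_ideal_v_number | apply: edge_ideal_regularity].
Qed.
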